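(* Let $\mathbf{a}=(a_1,a_2,\dots)$ be a sequence of positive numbers such that $a_n\to\infty$ and $|a_n-a_{n-1}|\to 0$ as $n\to\infty$. If the $\mathbf{a}$-walk is $C$-recurrent with positive probability for some $C>0$, then it is $\tilde C$-recurrent with positive probability for all $\tilde C>0$.
   Context: Let $X_1,X_2,\dots$ be i.i.d. with $P(X_i=1)=P(X_i=-1)=\frac12$. For a non-random sequence $\mathbf{a}=(a_1,a_2,\dots)$ of positive numbers, the $\mathbf{a}$-walk is $S(n)=\sum_{k=1}^n a_kX_k$, $S(0)=0$. For $C\ge 0$, the walk is $C$-recurrent if the event $\{|S(n)|\le C\}$ occurs for infinitely many $n$; ''$C$-recurrent with positive probability'' means $P(|S(n)|\le C\text{ for infinitely many }n)>0$. *)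

(* Defs.v *)
From HB Require Import structures.
From mathcomp Require Import all_boot all_order all_algebra.
From mathcomp Require Import finmap.
From mathcomp Require Import all_classical all_reals all_analysis.

Set Implicit Arguments.
Unset Strict Implicit.
Unset Printing Implicit Defensive.

Import Order.TTheory GRing.Theory Num.Theory.
Import numFieldNormedType.Exports.

Local Open Scope classical_set_scope.
Local Open Scope ring_scope.

(* Sequences are indexed from 0: [a k] and [X k] stand for $a_{k+1}$ and
   $X_{k+1}$. The index of the walk is not shifted. *)

Definition mutually_independent (d : measure_display) (T : measurableType d)
    (R : realType) (P : probability T R) (X : nat -> {RV P >-> R}) : Prop :=
  forall (J : {fset nat}) (B : nat -> set R),
    (forall j, j \in J -> measurable (B j)) ->
    P (\bigcap_(j in [set` J]) (X j @^-1` B j)) =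
    (\prod_(j <- J) P (X j @^-1` B j))%E.

Definition rademacher (d : measure_display) (T : measurableType d)
    (R : realType) (P : probability T R) (Y : {RV P >-> R}) : Prop :=
  P (Y @^-1` [set 1]) = (2^-1)%:E /\ P (Y @^-1` [set -1]) = (2^-1)%:E.

Definition iid_rademacher (d : measure_display) (T : measurableType d)
    (R : realType) (P : probability T R) (X : nat -> {RV P >-> R}) : Prop :=
  mutually_independent X /\ forall k, rademacher (X k).

Definition walk (d : measure_display) (T : measurableType d)
    (R : realType) (P : probability T R) (a : nat -> R)
    (X : nat -> {RV P >-> R}) (n : nat) (w : T) : R :=
  \sum_(0 <= k < n) a k * X k w.

Definition recurrence_event (d : measure_display) (T : measurableType d)
    (R : realType) (P : probability T R) (a : nat -> R)
    (X : nat -> {RV P >-> R}) (C : R) : set T :=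
  lim_sup_set (fun n => [set w | `|walk a X n w| <= C]).

Definition recurrent_with_pos_prob (d : measure_display) (T : measurableType d)
    (R : realType) (P : probability T R) (a : nat -> R)
    (X : nat -> {RV P >-> R}) (C : R) : Prop :=
  (0 < P (recurrence_event a X C))%E.

(* Main.v *)
Require Import Defs.
From HB Require Import structures.
From mathcomp Require Import all_boot all_order all_algebra.
From mathcomp Require Import finmap.
From mathcomp Require Import measurable_realfun ring lra.
From mathcomp Require Import all_classical all_reals all_analysis.

Set Implicit Arguments.
Unset Strict Implicit.
Unset Printing Implicit Defensive.

Import Order.TTheory GRing.Theory Num.Theory.
Import numFieldNormedType.Exports.

Local Open Scope classical_set_scope.
Local Open Scope ring_scope.

(** The walk [S] takes steps [+a_k] and [-a_k].  Everything rests on one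
    deterministic move: if [i < j] have opposite signs [X_i = s], [X_j = -s],
    then exchanging these two signs translates the walk, from time [j + 1] on,
    by [2 s (a_j - a_i)].  Since [a_n] goes to infinity with increments going
    to 0, the numbers [a_j - a_i], [j > i], come as close as desired to any
    prescribed nonnegative real once [i] is large
    ([slow_escape_increments]).  So the limit points of the walk can be moved
    essentially at will.

    Write [E] for the event that [|S - c| <= r] infinitely often.  Cutting
    [[-C, C]] in halves again and again, recurrence with positive probability
    to this interval yields a centre [c] for which [E] has positive probability
    with [r = C'/2] ([visits_small]).  It remains to bring [c] near 0.

    For each large [i] let [phi i > i] be such that exchanging the signs of
    [i] and [phi i] translates the walk by [-c] up to [C'/2].  Some such pair
    has the needed signs [(s, -s)] with positive probability inside [E]
    ([sign_change_pos_prob]).  Otherwise, almost surely on [E], a sign [s] at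
    [i] forces the sign [s] at [phi i], at [phi (phi i)], and so on; infinitely
    many prescribed signs are a null event, so on [E] the sign [s] almost
    surely never occurs at large indices, and this is a null event too.

    Finally the exchange keeps the probability positive.  The space carries
    no transformation that exchanges the signs, so the argument goes through
    independence: given the pattern at [i] and [j], the event [E] is an event
    about the other coordinates only, and those are independent of
    [(X_i, X_j)], by the pi-lambda theorem ([indep_off]).  The pattern can
    therefore be replaced by the opposite one ([resample_visits]). *)

(** * Upper limits of sets, measurability, finite sums *)

(** An upper limit only sees late times, so two walks that agree on [B] after
    time [N] can be compared there. *)
Lemma lim_sup_set_sub_on (T : Type) (F G : (set T)^nat) (B : set T) (N : nat) :
  (forall n, (N <= n)%N -> F n `&` B `<=` G n) ->
  lim_sup_set F `&` B `<=` lim_sup_set G.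
Proof.
move=> FG w [Fw Bw] n _; have [m /= nm Fmw] := Fw (maxn n N) I.
exists m => /=; first by rewrite (leq_trans _ nm)// leq_maxl.
by apply: FG => //; rewrite (leq_trans _ nm)// leq_maxr.
Qed.

Lemma lim_sup_setU (T : Type) (F G : (set T)^nat) :
  lim_sup_set (fun n => F n `|` G n) `<=` lim_sup_set F `|` lim_sup_set G.
Proof.
move=> w FGw; apply: contrapT => /not_orP[].
move=> /existsNP[n /not_implyP[_ nF]] /existsNP[m /not_implyP[_ nG]].
have [k /= mnk [Fk|Gk]] := FGw (maxn n m) I.
- by apply: nF; exists k => //=; rewrite (leq_trans _ mnk)// leq_maxl.
- by apply: nG; exists k => //=; rewrite (leq_trans _ mnk)// leq_maxr.
Qed.

Lemma lim_sup_set_measurable (d : measure_display) (T : measurableType d)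
    (F : (set T)^nat) :
  (forall n, measurable (F n)) -> measurable (lim_sup_set F).
Proof.
by move=> mF; apply: bigcapT_measurable => n; exact: bigcup_measurable.
Qed.

Lemma measurable_ball_preimage (d : measure_display) (T : measurableType d)
    (R : realType) (f : T -> R) (c r : R) : measurable_fun setT f ->
  measurable [set w | `|f w - c| <= r].
Proof.
move=> mf; rewrite (_ : mkset _ = f @^-1` [set t | `|t - c| <= r]); last by [].
rewrite -[X in measurable X]setTI; apply: mf => //.
rewrite (_ : mkset _ = `[c - r, c + r]%classic).
  exact: measurable_itv.
by apply/seteqP; split => t /=; rewrite in_itv/= ler_distl.
Qed.

Lemma sum_iota_fset (R : nmodType) (J : {fset nat}) (n : nat) (f : nat -> R) :
  (forall k, k \in J -> (k < n)%N) ->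
  \sum_(0 <= k < n) (if k \in J then f k else 0) = \sum_(k <- J) f k.
Proof.
move=> Jn; rewrite -big_mkcond/= -big_filter; apply: perm_big.
apply: uniq_perm; rewrite ?filter_uniq ?iota_uniq ?fset_uniq// => k.
rewrite mem_filter mem_index_iota /=.
by case: (boolP (k \in J)) => // /Jn ->.
Qed.

(** * Independence from finitely many coordinates *)

(** A pi-system generating the sigma-algebra of the [X k] with [k] not in
    [J]. *)
Definition cylinders_off (d : measure_display) (T : measurableType d)
    (R : realType) (P : probability T R) (X : nat -> {RV P >-> R})
    (J : {fset nat}) : set (set T) :=
  [set A | exists (K : {fset nat}) (V : nat -> set R),
    [/\ forall k, k \in K -> k \notin J, forall k, measurable (V k) &
        A = \bigcap_(k in [set` K]) (X k @^-1` V k)]].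

Section independence.
Context (d : measure_display) (T : measurableType d) (R : realType)
  (P : probability T R) (X : nat -> {RV P >-> R}).

Lemma measurable_cylinder (J : {fset nat}) (V : nat -> set R) :
  (forall k, measurable (V k)) ->
  measurable (\bigcap_(k in [set` J]) (X k @^-1` V k)).
Proof.
move=> mV; apply: fin_bigcap_measurable => [|k _]; first exact: finite_fset.
exact: measurable_funPTI.
Qed.

Lemma cylinders_off_measurable J : cylinders_off X J `<=` measurable.
Proof. by move=> _ [K [V [_ mV ->]]]; exact: measurable_cylinder. Qed.

Lemma cylinders_off_setI_closed J : setI_closed (cylinders_off X J).
Proof.
move=> _ _ [K [V [KJ mV ->]]] [L [W [LJ mW ->]]].
exists (K `|` L)%fset, (fun k => (if k \in K then V k else setT) `&`
                         (if k \in L then W k else setT)); split.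
- by move=> k; rewrite inE => /orP[/KJ|/LJ].
- by move=> k; apply: measurableI; case: ifP.
- apply/seteqP; split => [w [VKw WLw] k /= _|w VWw].
    by split; case: ifP => // kK; [exact: VKw|exact: WLw].
  split=> k /= kKL; have := VWw k; rewrite /= inE kKL ?orbT => /(_ isT)[];
    by [].
Qed.

(** The case of cylinders: both sides are one product over the disjoint union
    of [K] and [J]. *)
Lemma cylinder_indep (J K : {fset nat}) (V W : nat -> set R) :
  mutually_independent X ->
  (forall k, k \in K -> k \notin J) ->
  (forall k, measurable (V k)) -> (forall k, measurable (W k)) ->
  P (\bigcap_(k in [set` K]) (X k @^-1` W k) `&`
     \bigcap_(k in [set` J]) (X k @^-1` V k)) =
  (P (\bigcap_(k in [set` K]) (X k @^-1` W k)) *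
   P (\bigcap_(k in [set` J]) (X k @^-1` V k)))%E.
Proof.
move=> indX KJ mV mW; pose U k := if k \in J then V k else W k.
have KU k : k \in K -> U k = W k by move=> /KJ; rewrite /U => /negbTE ->.
have JU k : k \in J -> U k = V k by rewrite /U => ->.
have -> : \bigcap_(k in [set` K]) (X k @^-1` W k) `&`
     \bigcap_(k in [set` J]) (X k @^-1` V k) =
     \bigcap_(k in [set` (K `|` J)%fset]) (X k @^-1` U k).
  apply/seteqP; split => [w [WKw VJw] k /=|w Uw].
    rewrite inE => /orP[kK|kJ]; first by rewrite KU//; exact: WKw.
    by rewrite JU//; exact: VJw.
  split=> k /= kKJ; have := Uw k; rewrite /= inE kKJ ?orbT => /(_ isT).
  - by rewrite KU.
  - by rewrite JU.
rewrite !indX//; last by move=> k _; rewrite /U; case: ifP.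
rewrite (big_fsetID _ (mem J))/= [RHS]muleC; congr (_ * _)%E.
  rewrite (eq_fbigl _ (B := J)); last first.
    by move=> k; rewrite !inE/=; case: (k \in J); rewrite ?orbT ?andbF.
  by apply: eq_fbigr => k kJ _; rewrite JU.
rewrite (eq_fbigl _ (B := K)); last first.
  move=> k; rewrite !inE/=; case: (boolP (k \in K)) => [/KJ ->//|_].
  by case: (k \in J).
by apply: eq_fbigr => k kK _; rewrite KU.
Qed.

(** As set functions of [A], both sides are finite measures, and they agree on
    the pi-system [cylinders_off X J]; hence they agree on the sigma-algebra
    that it generates. *)
Lemma indep_off (J : {fset nat}) (V : nat -> set R) (A : set T) :
  mutually_independent X -> (forall k, measurable (V k)) ->
  <<s cylinders_off X J >> A ->
  P (A `&` \bigcap_(k in [set` J]) (X k @^-1` V k)) =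
  (P A * P (\bigcap_(k in [set` J]) (X k @^-1` V k)))%E.
Proof.
move=> indX mV; have mB := measurable_cylinder J mV.
set B := \bigcap_(_ in _) _ in mB *.
have PB_ge0 : 0 <= fine (P B) by exact/fine_ge0/measure_ge0.
move=> sA; rewrite [RHS]muleC.
have := @g_sigma_algebra_measure_unique _ _ _ (cylinders_off X J)
  (@cylinders_off_measurable J) (fun=> setT) _ _ (mrestr P mB)
  (mscale (NngNum PB_ge0) P) (@cylinders_off_setI_closed J) _ _ _ sA.
rewrite /= /mscale /mrestr/= fineK ?fin_num_measure//; apply.
- by move=> _; exists fset0, (fun=> setT); split => //; apply/seteqP; split.
- by rewrite bigcup_const//; exists 0%N.
- move=> _ [K [W [KJ mW ->]]]; rewrite [RHS]muleC.
  exact: cylinder_indep.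
- move=> _; apply: (le_lt_trans (probability_le1 _ _)); rewrite ?ltry//.
  exact: measurableI.
Qed.

(** [P (X (f 0) \in V, .., X (f (n-1)) \in V) = 2^-n] for every [n]. *)
Lemma infinite_repeat_null (f : nat -> nat) (V : set R) :
  mutually_independent X -> injective f -> measurable V ->
  (forall k, P (X k @^-1` V) = (2^-1)%:E) ->
  P (\bigcap_n (X (f n) @^-1` V)) = 0%E.
Proof.
move=> indX finj mV PV.
have mI : measurable (\bigcap_n (X (f n) @^-1` V)).
  by apply: bigcapT_measurable => n; exact: measurable_funPTI.
have le_half n : (P (\bigcap_n (X (f n) @^-1` V)) <= (2^-1 ^+ n)%:E)%E.
  pose J := [fset f k | k in iota 0 n]%fset.
  have -> : (2^-1 ^+ n)%:E = P (\bigcap_(k in [set` J]) (X k @^-1` V)).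
    rewrite indX//; under eq_bigr do rewrite PV.
    rewrite big_imfset/=; last by move=> ? ? _ _ /finj.
    rewrite prodEFin undup_id ?iota_uniq// big_const_seq count_predT size_iota.
    by rewrite iter_mulr mulr1.
  apply: le_measure; rewrite ?inE//.
    exact: measurable_cylinder.
  by move=> w fw _ /= /imfsetP[k _ ->]; exact: fw.
apply/eqP; rewrite eq_le measure_ge0 andbT.
have half_cvg : (2^-1 ^+ n : R) @[n --> \oo] --> (0 : R).
  by apply: cvg_expr; rewrite ger0_norm// invf_lt1// ltr1n.
rewrite -[P _]fineK ?fin_num_measure// lee_fin.
apply: (cvgr_to_ge half_cvg); apply: nearW => n.
by rewrite -lee_fin fineK ?fin_num_measure.
Qed.

End independence.

(** * Changing finitely many signs *)

Section resampling.
Context (d : measure_display) (T : measurableType d) (R : realType)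
  (P : probability T R) (X : nat -> {RV P >-> R}) (a : nat -> R).

Definition visits (c r : R) : set T :=
  lim_sup_set (fun n => [set w | `|walk a X n w - c| <= r]).

(** The walk with the signs at [J] replaced by the constants [x]; it depends on
    the other signs only. *)
Definition pinned_walk (J : {fset nat}) (x : nat -> R) (n : nat) (w : T) : R :=
  \sum_(0 <= k < n) a k * (if k \in J then x k else X k w).

Lemma measurable_visits c r : measurable (visits c r).
Proof.
apply: lim_sup_set_measurable => n; apply: measurable_ball_preimage.
by apply: measurable_sum => k; exact: measurable_funM.
Qed.

Lemma pinned_walk_visits_off (J : {fset nat}) (x : nat -> R) (c r : R) :
  <<s cylinders_off X J >>
    (lim_sup_set (fun n => [set w | `|pinned_walk J x n w - c| <= r])).
Proof.
(* [TJ] is the type [T] carrying the smaller sigma-algebra, so that the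
   measurability lemmas apply to it. *)
pose TJ : measurableType _ := g_sigma_algebraType (cylinders_off X J).
change (@measurable _ TJ
  (lim_sup_set (fun n => [set w | `|pinned_walk J x n w - c| <= r]))).
apply: bigcapT_measurable => m; apply: bigcup_measurable => n _.
apply: (@measurable_ball_preimage _ TJ R).
apply: (@measurable_sum _ TJ) => k.
apply: measurable_funM; first exact: measurable_cst.
case: (boolP (k \in J)) => [_|kJ]; first exact: measurable_cst.
move=> _ B mB; change (<<s cylinders_off X J >> (setT `&` (X k @^-1` B))).
rewrite setTI; apply: sub_sigma_algebra.
exists [fset k]%fset, (fun=> B); split => //.
- by move=> j; rewrite inE => /eqP ->.
- apply/seteqP; split => [w XB j|w]; first by rewrite /= inE => /eqP ->.
  by apply; rewrite /= inE.
Qed.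

(** On [X = x on J] the walk is the walk pinned at [x], and its visits form an
    event [F] of the remaining signs.  Independence turns the positivity of
    [P (F, X = x on J)] into that of [P F], and then of [P (F, X = y on J)];
    on the latter event the walk is the pinned one plus a constant, as soon as
    time has passed all of [J]. *)
Lemma resample_visits (J : {fset nat}) (x y : nat -> R) (c r : R) :
  mutually_independent X ->
  (forall k, k \in J -> (0 < P (X k @^-1` [set y k]))%E) ->
  (0 < P (visits c r `&` \bigcap_(k in [set` J]) (X k @^-1` [set x k])))%E ->
  (0 < P (visits (c + \sum_(k <- J) a k * (y k - x k)) r))%E.
Proof.
move=> indX Py.
pose F := lim_sup_set (fun n => [set w | `|pinned_walk J x n w - c| <= r]).
have sF : <<s cylinders_off X J >> F by exact: pinned_walk_visits_off.
have mF : measurable F.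
  exact: (smallest_sub (@sigma_algebra_measurable _ T)
    (@cylinders_off_measurable _ _ _ P X J)).
have walkE z n w : (\bigcap_(k in [set` J]) (X k @^-1` [set z k])) w ->
    walk a X n w = pinned_walk J z n w.
  by move=> zw; apply: eq_bigr => k _; case: ifP => // kJ; rewrite zw.
set Bx := \bigcap_(_ in _) _.
have mBx : measurable Bx by exact: measurable_cylinder.
pose By := \bigcap_(k in [set` J]) (X k @^-1` [set y k]).
have mBy : measurable By by exact: measurable_cylinder.
move=> PEx.
have PF : (0 < P F)%E.
  apply: (lt_le_trans PEx); apply: le_measure; rewrite ?inE//.
    by apply: measurableI => //; exact: measurable_visits.
  apply: (@lim_sup_set_sub_on _ _ _ _ 0) => n _ w /= [+ Bw].
  by rewrite (walkE x).
have PBy : (0 < P By)%E.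
  rewrite /By indX//= big_seq.
  by elim/big_ind : _ => // u v u0 v0; exact: mule_gt0.
have: (0 < P (F `&` By))%E.
  by rewrite (indep_off (V := fun k => [set y k]))//; exact: mule_gt0.
move=> /lt_le_trans; apply; apply: le_measure; rewrite ?inE.
- exact: measurableI.
- exact: measurable_visits.
apply: (@lim_sup_set_sub_on _ _ _ _ (\max_(k <- J) k).+1) => n Jn w /= [+ Bw].
rewrite (walkE y)//.
have -> : pinned_walk J y n w =
    pinned_walk J x n w + \sum_(k <- J) a k * (y k - x k).
  rewrite -(sum_iota_fset (n := n)); last first.
    move=> k kJ; apply: leq_trans Jn; rewrite ltnS.
    exact: (leq_bigmax_seq (F := fun k : nat => k)).
  rewrite -big_split/=.
  by apply: eq_bigr => k _; case: ifP => _; ring.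
by rewrite opprD addrACA subrr addr0.
Qed.

End resampling.

(** * Exchanging two opposite signs *)

Section flipping.
Context (d : measure_display) (T : measurableType d) (R : realType)
  (P : probability T R) (X : nat -> {RV P >-> R}) (a : nat -> R).

Lemma flip_pair_visits (i j : nat) (s c r : R) :
  iid_rademacher X -> s = 1 \/ s = -1 -> (i < j)%N ->
  (0 < P (visits X a c r `&`
          (X i @^-1` [set s] `&` X j @^-1` [set (- s)%R])))%E ->
  (0 < P (visits X a (c + s * (2 * (a j - a i)))%R r))%E.
Proof.
move=> [indX rad] s1 ij PE.
pose x k := if k == i then s else - s.
have xi : x i = s by rewrite /x eqxx.
have xj : x j = - s by rewrite /x gtn_eqF.
have Px k : (0 < P (X k @^-1` [set (- x k)%R]))%E.
  rewrite /x; have [P1 PN1] := rad k.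
  by case: ifP => _; case: s1 => ->; rewrite ?opprK ?P1 ?PN1 lte_fin invr_gt0.
have := @resample_visits _ _ _ _ X a [fset i; j]%fset x (fun k => - x k) c r
  indX (fun k _ => Px k).
rewrite big_fsetU1 ?inE ?ltn_eqF//= big_seq_fset1 xi xj.
have -> : a i * (- s - s) + a j * (- - s - - s) = s * (2 * (a j - a i)) by ring.
apply; rewrite (_ : \bigcap_(k in _) _ =
  X i @^-1` [set s] `&` X j @^-1` [set - s])//.
apply/seteqP; split => [w xw|w [/= wi wj] k /=].
  by split; [rewrite -xi|rewrite -xj]; apply: xw; rewrite /= !inE eqxx ?orbT.
by rewrite !inE => /orP[] /eqP ->; rewrite ?xi ?xj.
Qed.

(** The law of a Rademacher variable is prescribed, its values are not: the
    dichotomy [X k = s] or [X k = - s] holds only almost surely. *)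
Lemma rademacher_off_null (k : nat) (s : R) :
  iid_rademacher X -> s = 1 \/ s = -1 ->
  P.-negligible (X k @^-1` (~` [set s; - s])).
Proof.
have half2 : 2^-1 + 2^-1 = 1 :> R by lra.
move=> [_ rad] s1; have [P1 PN1] := rad k.
apply/negligibleP.
  by apply: measurable_funPTI; apply: measurableC; apply: measurableU.
have m1 z : measurable (X k @^-1` [set z]) by exact: measurable_funPTI.
rewrite -preimage_setC preimage_setU.
apply: (eq_trans (probability_setC P (measurableU _ _ (m1 s) (m1 (- s))))).
rewrite measureU//; last first.
  apply/seteqP; split => // w /= [-> ss].
  by clear P1 PN1; case: s1 ss => -> ss; lra.
have -> : (P (X k @^-1` [set s]) + P (X k @^-1` [set (- s)%R]) = 1)%E.
  by case: s1 => ->; rewrite ?opprK P1 PN1 -EFinD half2.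
by rewrite subee.
Qed.

(** If no [i] works then, outside a null set, the sign [s] propagates on [E]
    along the orbit of [phi].  Hence a point of [E] carries either a whole orbit
    of signs [s], or no sign [s] at all after [N].  Both are null events by
    [infinite_repeat_null], which contradicts [0 < P E]. *)
Lemma sign_change_pos_prob (E : set T) (N : nat) (phi : nat -> nat) (s : R) :
  iid_rademacher X -> s = 1 \/ s = -1 -> measurable E -> (0 < P E)%E ->
  (forall i, (N <= i)%N -> (i < phi i)%N) ->
  exists2 i, (N <= i)%N &
    (0 < P (E `&` (X i @^-1` [set s] `&` X (phi i) @^-1` [set (- s)%R])))%E.
Proof.
have half1 : 1 - 2^-1 = 2^-1 :> R by lra.
move=> iidX s1 mE PE phi_gt; have [indX rad] := iidX.
have mX k z : measurable (X k @^-1` [set z]) by exact: measurable_funPTI.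
have Ps k : P (X k @^-1` [set s]) = (2^-1)%:E.
  by have [P1 PN1] := rad k; case: s1 => ->.
apply: contrapT => no_change.
have change_null i : (N <= i)%N -> P.-negligible
    (E `&` (X i @^-1` [set s] `&` X (phi i) @^-1` [set - s])).
  move=> Ni; apply/negligibleP; first by do 2 apply: measurableI => //.
  apply: contrapT => /eqP P0; apply: no_change; exists i => //.
  by rewrite lt_neqAle eq_sym P0 measure_ge0.
have iter_ge i m : (N <= i)%N -> (i <= iter m phi i)%N.
  move=> Ni; elim: m => //= m IH; apply: (leq_trans IH).
  by apply/ltnW/phi_gt/(leq_trans Ni).
have const_null i : (N <= i)%N -> P.-negligible
    (\bigcap_m (X (iter m phi i) @^-1` [set s])).
  move=> Ni; apply/negligibleP; first exact: bigcapT_measurable.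
  apply: infinite_repeat_null => //.
  apply: incn_inj; apply: leq_mono => m n.
  elim: n => // n IH; rewrite ltnS leq_eqVlt => /orP[/eqP ->|/IH mn] /=.
    by apply: phi_gt; apply: (leq_trans Ni); exact: iter_ge.
  apply: (ltn_trans mn); apply: phi_gt; apply: (leq_trans Ni); exact: iter_ge.
have never_null : P.-negligible (\bigcap_m (X (N + m)%N @^-1` (~` [set s]))).
  apply/negligibleP.
    apply: bigcapT_measurable => m; rewrite -preimage_setC.
    exact: measurableC.
  apply: infinite_repeat_null => //; [exact: addnI|exact: measurableC|].
  move=> k; rewrite -preimage_setC probability_setC// Ps.
  by rewrite -EFinB half1.
suff : P.-negligible E.
  by move/negligibleP => /(_ mE) PE0; rewrite PE0 ltxx in PE.
apply: (@negligibleS _ _ _ _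
  ((\bigcup_k (((E `&` (X (N + k)%N @^-1` [set s] `&`
                        X (phi (N + k)%N) @^-1` [set - s])) `|`
              (\bigcap_m (X (iter m phi (N + k)%N) @^-1` [set s])))`|`
              (X k @^-1` (~` [set s; - s])))) `|`
   \bigcap_m (X (N + m)%N @^-1` (~` [set s])))); last first.
  apply: negligibleU => //; apply: negligible_bigcup => k.
  apply: negligibleU; last exact: rademacher_off_null.
  by apply: negligibleU; [apply: change_null|apply: const_null]; exact: leq_addr.
move=> w Ew; apply: contrapT => /not_orP[wbad]; apply => m _ /= wm.
apply: wbad; apply: contrapT => nbad.
have follow i : (N <= i)%N -> X i w = s -> X (phi i) w = s.
  move=> Ni wi; apply: contrapT => wphi; apply: nbad.
  (* A value other than [s] and [- s] lies in a null set of
     [rademacher_off_null]. *)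
  have [wN|wN] := pselect (X (phi i) w = - s).
    by exists (i - N)%N => //; left; left; rewrite subnKC.
  by exists (phi i) => //; right => -[].
apply: nbad; exists m => //; left; right => n _ /=.
elim: n => //= n IH; apply: follow => //.
by apply: (leq_trans (leq_addr m N)); apply: iter_ge; exact: leq_addr.
Qed.

(** An interval is the union of its two halves, and infinitely many visits to
    a union mean infinitely many visits to one of the parts. *)
Lemma visits_half (c r : R) : (0 < P (visits X a c r))%E ->
  exists c', (0 < P (visits X a c' (r / 2)%R))%E.
Proof.
move=> Pc; apply: contrapT => /forallNP no.
have null c' : P.-negligible (visits X a c' (r / 2)).
  apply/negligibleP; first exact: measurable_visits.
  by apply/eqP; rewrite -measure_le0 leNgt; apply/negP/no.
suff /negligibleP : P.-negligible (visits X a c r).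
  by move=> /(_ (measurable_visits _ _ _ _)) P0; rewrite P0 ltxx in Pc.
apply: (negligibleS _ (negligibleU (null (c - r / 2)) (null (c + r / 2)))).
apply: subset_trans; last exact: lim_sup_setU.
rewrite -[X in X `<=` _]setIT.
apply: (@lim_sup_set_sub_on _ _ _ _ 0) => n _ w [/= + _].
rewrite !ler_distl => /andP[cw wc].
have [wlt|cle] := leP (walk a X n w) c; [left|right]; apply/andP; split; lra.
Qed.

Lemma visits_small (c r delta : R) : 0 < delta ->
  (0 < P (visits X a c r))%E -> exists c', (0 < P (visits X a c' delta))%E.
Proof.
move=> delta0 Pc.
have halves n : exists c', (0 < P (visits X a c' (r * 2^-1 ^+ n)%R))%E.
  elim: n => [|n [c' /visits_half]]; first by exists c; rewrite expr0 mulr1.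
  by rewrite -mulrA -exprSr.
have : (r * 2^-1 ^+ n : R) @[n --> \oo] --> (0 : R).
  rewrite -[X in _ --> X](mulr0 r); apply: cvgM; first exact: cvg_cst.
  by apply: cvg_expr; rewrite ger0_norm// invf_lt1// ltr1n.
move=> /cvgr0_norm_le /(_ _ delta0) [n _ /(_ n (leqnn n)) rn].
have [c' Pc'] := halves n; exists c'; apply: (lt_le_trans Pc').
apply: le_measure; rewrite ?inE; [exact: measurable_visits..|].
rewrite -[X in X `<=` _]setIT.
apply: (@lim_sup_set_sub_on _ _ _ _ 0) => k _ w [/= + _] => /le_trans; apply.
exact: ler_normlW.
Qed.

End flipping.

(** Take the first [j > i] with [y <= a j - a i]: the previous term was at most
    [y] above [a i], and the last increment is at most [e]. *)
Lemma slow_escape_increments (R : realType) (a : nat -> R) (e : R) :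
  0 < e -> a n @[n --> \oo] --> +oo -> `|a n.+1 - a n| @[n --> \oo] --> 0 ->
  exists N, forall i y, (N <= i)%N -> 0 <= y ->
    exists2 j, (i < j)%N & y <= a j - a i <= y + e.
Proof.
move=> e0 aoo a0.
have [N _ Ne] : \forall n \near \oo, `|a n.+1 - a n| <= e.
  move: a0 => /cvgr0_norm_le/(_ _ e0); apply: filterS => n.
  by rewrite normr_id.
exists N => i y Ni y0.
have exj : exists j, (i < j)%N && (y <= a j - a i).
  have [M _ aM] := (iffLR (cvgryPge a) aoo) (y + a i).
  exists (maxn i.+1 M); rewrite leq_maxl /= lerBrDr.
  by apply: aM; rewrite /= leq_maxr.
have [[//|j] /andP[ij yj] jmin] := ex_minnP exj.
exists j.+1 => //; rewrite yj /=.
have aj : a j - a i <= y.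
  move: ij; rewrite ltnS leq_eqVlt => /orP[/eqP <-|ij]; first by rewrite subrr.
  rewrite leNgt; apply/negP => yj'; have := jmin j.
  by rewrite ij (ltW yj') ltnn => /(_ isT).
have /ler_normlW : `|a j.+1 - a j| <= e.
  by apply: Ne => /=; exact: (leq_trans Ni).
lra.
Qed.

Theorem theorem1 (d : measure_display) (T : measurableType d) (R : realType)
    (P : probability T R) (X : nat -> {RV P >-> R}) (a : nat -> R) :
  iid_rademacher X ->
  (forall k, 0 < a k) ->
  a n @[n --> \oo] --> +oo ->
  `|a n.+1 - a n| @[n --> \oo] --> 0 ->
  (exists2 C : R, 0 < C & recurrent_with_pos_prob a X C) ->
  forall C' : R, 0 < C' -> recurrent_with_pos_prob a X C'.
Proof.
move=> iidX _ aoo a0 [C _ recC] C' C'0.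
have visits0 r : recurrence_event a X r = visits X a 0 r.
  by congr lim_sup_set; apply/funext => n; apply/seteqP; split=> w /=;
    rewrite subr0.
rewrite /recurrent_with_pos_prob visits0.
move: recC; rewrite /recurrent_with_pos_prob visits0 => recC.
(* The gap [a j - a i] counts twice in the translation, so its error [C' / 4]
   and the radius [C' / 2] add up to [C']. *)
have half0 : 0 < C' / 2 by rewrite divr_gt0.
have quarter0 : 0 < C' / 4 by rewrite divr_gt0.
have [c Pc] := visits_small half0 recC.
have [N gap] := slow_escape_increments quarter0 aoo a0.
(* The exchange must translate by about [- c], so [s] is opposite to [c]. *)
pose s : R := if c <= 0 then 1 else -1.
have s1 : s = 1 \/ s = -1 by rewrite /s; case: ifP; [left|right].
have /choice[phi phiP] : forall i, exists j, (N <= i)%N ->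
    (i < j)%N /\ `|c| / 2 <= a j - a i <= `|c| / 2 + C' / 4.
  move=> i; have [Ni|iN] := leqP N i; last by exists 0%N.
  have [j ij aij] := gap i (`|c| / 2) Ni (divr_ge0 (normr_ge0 c) (ler0n _ 2)).
  by exists j.
have phi_gt i : (N <= i)%N -> (i < phi i)%N by move=> /phiP[].
have mE := measurable_visits X a c (C' / 2).
have [i Ni Pi] := sign_change_pos_prob iidX s1 mE Pc phi_gt.
have [ij /andP[lo hi]] := phiP i Ni.
apply: (lt_le_trans (flip_pair_visits iidX s1 ij Pi)).
apply: le_measure; rewrite ?inE; [exact: measurable_visits..|].
rewrite -[X in X `<=` _]setIT.
apply: (@lim_sup_set_sub_on _ _ _ _ 0) => n _ w [/= + _].
rewrite subr0 ler_distl ler_norml => /andP[wlo whi].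
move: lo hi wlo whi; rewrite /s; case: (leP c 0) => c0.
  rewrite ler0_norm// => lo hi wlo whi; apply/andP; split; lra.
rewrite gtr0_norm// => lo hi wlo whi; apply/andP; split; lra.
Qed.
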